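(* Let $n\ge 3$ and $r$ be integers. If $r > \binom{\lceil 2\sqrt{n}\rceil}{2} \lfloor n/2 \rfloor + \lceil 2\sqrt{n}\rceil$, then ${\rm sg}(P_r\,\square\, C_n)= \lceil 2\sqrt{n}\, \rceil$.
   Context: $P_m$ denotes the path with vertex set $\{1,\dots,m\}$ and edges $\{i,i+1\}$; $C_n$ ($n\ge 3$) denotes the cycle with vertex set $\{1,\dots,n\}$ and edges $\{i,i+1\}$ and $\{n,1\}$. The Cartesian product $G\,\square\, H$ has vertex set $V(G)\times V(H)$, with $(g,h)$ adjacent to $(g',h')$ iff either $g=g'$ and $hh'\in E(H)$, or $h=h'$ and $gg'\in E(G)$. For a graph $G=(V,E)$ and $S\subseteq V$, for each pair $\{x,y\}\subseteq S$ with $x\neq y$ let $\widetilde{P}(x,y)$ be a selected fixed shortest $x,y$-path, and let $\widetilde{I}(S)=\{\widetilde{P}(x,y): x,y\in S\}$. $S$ is a strong geodetic set if for some such choice of geodesics, every vertex of $G$ lies on some path of $\widetilde{I}(S)$. The strong geodetic number ${\rm sg}(G)$ is the minimum cardinality of a strong geodetic set of $G$. *)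

(* Defs.v *)
From mathcomp Require Import all_boot all_order all_algebra.
From mathcomp Require Import reals.

Set Implicit Arguments.
Unset Strict Implicit.
Unset Printing Implicit Defensive.

Import Order.TTheory GRing.Theory Num.Theory.

(* A graph on a finite vertex type [T] is given by its adjacency relation
   [e : rel T]; it is a simple graph when [e] is symmetric and irreflexive. *)

(* Vertices are numbered from 0 ('I_m is {0, ..., m-1}) instead of from 1. *)
Definition path_graph (m : nat) : rel 'I_m :=
  fun i j => (i.+1 == j) || (j.+1 == i).

Definition cycle_graph (n : nat) : rel 'I_n :=
  fun i j => [|| i.+1 == j, j.+1 == i,
                 (i == n.-1 :> nat) && (j == 0 :> nat) |
                 (j == n.-1 :> nat) && (i == 0 :> nat)].

Definition cartesian_product (T U : finType) (e : rel T) (f : rel U) :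
    rel (T * U)%type :=
  fun x y => ((x.1 == y.1) && f x.2 y.2) || ((x.2 == y.2) && e x.1 y.1).

Section StrongGeodetic.
Variables (T : finType) (e : rel T).

(* [s] lists all the vertices of the path, both endpoints included. *)
Definition is_path (x y : T) (s : seq T) : bool :=
  [&& sorted e s, uniq s, ohead s == Some x & last x s == y].

Definition geodesic (x y : T) (s : seq T) : Prop :=
  is_path x y s /\ forall t, is_path x y t -> size s <= size t.

(* One geodesic is selected per unordered pair {x, y}: the condition
   [P y x = rev (P x y)] forces (x, y) and (y, x) to select the same path,
   read in opposite directions. *)
Definition strong_geodetic (S : {set T}) : Prop :=
  exists P : T -> T -> seq T,
    (forall x y, x \in S -> y \in S -> x != y ->
       geodesic x y (P x y) /\ P y x = rev (P x y)) /\
    (forall v, exists x y,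
       [/\ x \in S, y \in S, x != y & v \in P x y]).

(* [has_sg k] is "sg(G) = k".  It is a relation and not a function because a
   disconnected graph may have no strong geodetic set at all. *)
Definition has_sg (k : nat) : Prop :=
  (exists S : {set T}, strong_geodetic S /\ #|S| = k) /\
  (forall S : {set T}, strong_geodetic S -> k <= #|S|).

End StrongGeodetic.

Lemma path_graph_sym m : symmetric (@path_graph m).
Proof. by move=> i j; rewrite /path_graph orbC. Qed.

Lemma path_graph_irr m : irreflexive (@path_graph m).
Proof. by move=> i; rewrite /path_graph orbb gtn_eqF. Qed.

Lemma cycle_graph_sym n : symmetric (@cycle_graph n).
Proof.
move=> i j; rewrite /cycle_graph orbCA; congr [|| _, _ | _].
exact: orbC.
Qed.

Lemma cycle_graph_irr n : 3 <= n -> irreflexive (@cycle_graph n).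
Proof.
move=> n3 i; rewrite /cycle_graph !orbb gtn_eqF //=.
by apply/negP => /andP[/eqP -> /eqP]; case: n n3 {i} => [|[|n]].
Qed.

(* The natural number \lceil 2 \sqrt n \rceil; [Num.ceil] is an integer, here
   nonnegative, so that its absolute value is itself. *)
Definition ceil_2sqrt (R : realType) (n : nat) : nat :=
  absz (Num.ceil (2%:R * Num.sqrt n%:R : R)%R).

(* Main.v *)
Require Import Defs.
From mathcomp Require Import all_boot all_order all_algebra.
From mathcomp Require Import reals.
From mathcomp Require Import zify.
From mathcomp Require boolp.

Set Implicit Arguments.
Unset Strict Implicit.
Unset Printing Implicit Defensive.

(* Lower bound: a geodesic has at most n/2 edges along the cycle, so when r is
   large some layer {i} x C_n contains neither a vertex of S nor a cycle edge of
   a selected geodesic.  That layer meets each geodesic at most once, and only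
   if its endpoints lie on opposite sides; hence n <= ab with a + b = |S|, and
   4n <= |S|^2.

   Upper bound: given n <= ab, put b consecutive vertices in the last layer, cut
   the columns into at most a blocks of length at most b, and put one vertex per
   block in the first layer, in a suitable column of the block.  Each column c
   of the block lies on a shortest arc from that column to a bottom column
   depending injectively on c, so one geodesic per column can run through the
   whole column. *)

Import Order.TTheory GRing.Theory Num.Theory.

(** * Paths and the selection of geodesics *)

Section Geodesics.
Variables (T : finType) (e : rel T).

Lemma is_pathP x y s :
  reflect (exists p, [/\ s = x :: p, path e x p, uniq (x :: p) & last x p = y])
          (is_path e x y s).
Proof.
apply: (iffP idP).
- case: s => [|z p] /and4P[sp up]; first by [].
  by move=> /eqP[zx] /eqP <-; subst z; exists p.
- by case=> p [-> sp up lp]; apply/and4P; split=> //=; rewrite ?lp.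
Qed.

Lemma is_path_rev x y s : symmetric e -> is_path e x y s -> is_path e y x (rev s).
Proof.
move=> esym /is_pathP[p [-> pp up lp]].
have sp : sorted e (rev (x :: p)).
  rewrite rev_sorted; apply: sub_path pp => u v; by rewrite esym.
rewrite /is_path sp rev_uniq up /= -lp.
case/lastP: p {pp up lp sp} => [|p z]; first by rewrite /= !eqxx.
by rewrite rev_cons rev_rcons /= !last_rcons !eqxx.
Qed.

Lemma geodesic_rev x y s : symmetric e -> geodesic e x y s -> geodesic e y x (rev s).
Proof.
move=> esym [ps mins]; split; first exact: is_path_rev.
move=> t pt; rewrite size_rev -(size_rev t); exact/mins/is_path_rev.
Qed.

(** [w] assigns each vertex to a pair, and one geodesic must serve all vertices assigned to that
    pair. The injective [rk] orients unordered pairs; the opposite orientation receives the reversed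
    geodesic. *)
Lemma strong_geodetic_of_cover (S : {set T}) (rk : T -> nat) (w : T -> T * T) :
    symmetric e -> injective rk ->
    (forall v, [/\ (w v).1 \in S, (w v).2 \in S & rk (w v).1 < rk (w v).2]) ->
    (forall x y, exists s, geodesic e x y s /\ forall v, w v = (x, y) -> v \in s) ->
  strong_geodetic e S.
Proof.
move=> esym rk_inj wS cov.
have [g gP] := boolp.choice (fun xy : T * T => cov xy.1 xy.2).
exists (fun x y => if rk x < rk y then g (x, y) else rev (g (y, x))); split.
- move=> x y _ _ xy.
  have := gP (x, y); have := gP (y, x); rewrite /= => -[gyx _] [gxy _].
  case: ltngtP => [lt|lt|/rk_inj eq_xy]; last by rewrite eq_xy eqxx in xy.
  + by [].
  + by rewrite revK; split=> //; apply: geodesic_rev.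
- move=> v; have [w1 w2 lt] := wS v.
  exists (w v).1, (w v).2; split=> //.
    by apply: contraTneq lt => ->; rewrite ltnn.
  rewrite lt; have [_] := gP ((w v).1, (w v).2); apply.
  by case: (w v).
Qed.

End Geodesics.

(** * Distance in the cylinder *)

Definition line_dist (i j : nat) : nat := (i - j) + (j - i).
Definition cycle_dist (n p q : nat) : nat :=
  minn (line_dist p q) (n - line_dist p q).

Definition cylinder (r n : nat) : rel ('I_r * 'I_n) :=
  cartesian_product (@path_graph r) (@cycle_graph n).

Definition cylinder_dist (r n : nat) (x y : 'I_r * 'I_n) : nat :=
  line_dist x.1 y.1 + cycle_dist n x.2 y.2.

Section Cylinder.
Variables r n : nat.
Implicit Types (x y z v : 'I_r * 'I_n) (i : 'I_r).
Local Notation E := (@cylinder r n).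
Local Notation D := (@cylinder_dist r n).

Lemma cylinder_sym : symmetric E.
Proof.
move=> x y; rewrite /cylinder /cartesian_product path_graph_sym cycle_graph_sym.
by rewrite (eq_sym x.1) (eq_sym x.2).
Qed.

Lemma cylinder_dist_adj x y z : E x y -> D x z <= (D y z).+1.
Proof.
case: x y z => [i p] [j q] [l t].
rewrite /cylinder /cartesian_product /path_graph /cycle_graph /cylinder_dist.
rewrite /cycle_dist /line_dist -!val_eqE /=.
have := ltn_ord p; have := ltn_ord q; have := ltn_ord t => lt_t lt_q lt_p.
case/orP=> /andP[/eqP ->]; last by case/orP => /eqP; lia.
by case/or4P=> [/eqP|/eqP|/andP[/eqP + /eqP]|/andP[/eqP + /eqP]]; lia.
Qed.

Lemma cylinder_dist_step x z :
  x != z -> exists2 y, E x y & D x z = (D y z).+1.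
Proof.
case: x z => [i p] [l t].
have [il neq|neq_il _] := eqVneq i l; last first.
  have lt_j : (if i < l then i.+1 else i.-1) < r.
    by have := ltn_ord i; have := ltn_ord l; case: ifP; lia.
  exists (Ordinal lt_j, p);
    move: neq_il; rewrite /cylinder /cartesian_product /path_graph /cycle_graph;
    rewrite /cylinder_dist /cycle_dist /line_dist -!val_eqE /=;
    by case: ifP; lia.
subst l; have {neq} neq_pt : p != t by apply: contraNneq neq => ->.
(* Step directly towards [t] if that arc has at most n/2 edges, otherwise the other way, wrapping
   between 0 and n - 1. *)
have lt_q : (if p < t then
       if (t - p).*2 <= n then p.+1 else if p == 0 :> nat then n.-1 else p.-1
     else
       if (p - t).*2 <= n then p.-1 else if p == n.-1 :> nat then 0 else p.+1) < n.
  have := ltn_ord p; have := ltn_ord t; repeat case: ifP; lia.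
exists (i, Ordinal lt_q);
  move: neq_pt; rewrite /cylinder /cartesian_product /path_graph /cycle_graph;
  rewrite /cylinder_dist /cycle_dist /line_dist -!val_eqE /=;
  have := ltn_ord p; have := ltn_ord t; repeat case: ifP; lia.
Qed.

Lemma cylinder_distxx x : D x x = 0.
Proof. by rewrite /cylinder_dist /cycle_dist /line_dist !subnn min0n. Qed.

Lemma cylinder_dist_le_size x p : path E x p -> D x (last x p) <= size p.
Proof.
elim: p x => [|y p IH] x /=; first by rewrite cylinder_distxx.
by case/andP=> xy /IH le; apply: leq_trans (cylinder_dist_adj _ xy) _.
Qed.

Lemma exists_shortest_walk x z :
  exists p, [/\ path E x p, last x p = z & size p = D x z].
Proof.
have [d] := ubnP (D x z); elim: d x => // d IH x ltd.
have [->|neq] := eqVneq x z; first by exists [::]; rewrite cylinder_distxx.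
have [y xy Dxy] := cylinder_dist_step neq.
have [|p [pp lp sp]] := IH y; first by rewrite Dxy in ltd.
by exists (y :: p); rewrite /= xy pp lp sp Dxy.
Qed.

(** Shortening the walk gives a path on vertices of the walk, and its length cannot drop below the
    distance; hence the walk repeats no vertex. *)
Lemma shortest_walk_geodesic x p :
  path E x p -> size p = D x (last x p) -> geodesic E x (last x p) (x :: p).
Proof.
move=> pp sp; split; last first.
  move=> t /is_pathP[q [-> qp _ lq]].
  by rewrite /= ltnS sp -lq cylinder_dist_le_size.
apply/is_pathP; exists p; split=> //.
have [p' [pp' up' lp sub]] : exists p',
    [/\ path E x p', uniq (x :: p'), last x p' = last x p & {subset p' <= p}].
  by case: (shortenP pp) => p'; exists p'.
apply: (leq_size_uniq up'); last first.
  by rewrite /= ltnS sp -lp cylinder_dist_le_size.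
by move=> v; rewrite !inE => /predU1P[->|/sub ->]; rewrite ?eqxx ?orbT.
Qed.

Lemma size_geodesic x y s : geodesic E x y s -> size s = (D x y).+1.
Proof.
case=> /is_pathP[p [-> pp _ lp]] mins; apply/eqP; rewrite eqn_leq.
rewrite /= !ltnS -{2}lp cylinder_dist_le_size // andbT.
have [q [pq lq sq]] := exists_shortest_walk x y.
have := @shortest_walk_geodesic x q pq; rewrite lq sq => -[] // qgeo _.
by have := mins _ qgeo; rewrite /= sq ltnS.
Qed.

(** * Layers met by geodesics, and the lower bound *)

Definition layer_between x y i : bool := (x.1 <= i <= y.1) || (y.1 <= i <= x.1).

Definition layer_count (s : seq ('I_r * 'I_n)) i : nat := count (fun v => v.1 == i) s.

(** Discrete intermediate values: an edge changes the layer by at most one. *)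
Lemma walk_meets_layer x p i :
  path E x p -> layer_between x (last x p) i -> 0 < layer_count (x :: p) i.
Proof.
rewrite /layer_between /layer_count -has_count.
elim: p x => [|y p IH] x /=.
  by move=> _; rewrite orbF -val_eqE /=; lia.
case/andP=> xy /IH {}IH btw; have [//|neq] := eqVneq x.1 i; apply: IH.
move: xy neq btw; rewrite /cylinder /cartesian_product /path_graph.
by case/orP=> /andP[/eqP eq_xy]; rewrite -?eq_xy -!val_eqE /=; lia.
Qed.

Lemma sum_layer_count s : \sum_i layer_count s i = size s.
Proof.
rewrite /layer_count; elim: s => [|v s IH] /=; first by rewrite big1.
rewrite big_split /= IH (bigD1 v.1) //= eqxx big1 // => i neq.
by rewrite eq_sym (negbTE neq).
Qed.

Lemma sum_layer_between x y : \sum_i layer_between x y i = (line_dist x.1 y.1).+1.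
Proof.
have sumE lo hi m : \sum_(i < m) (lo <= i <= hi) = minn m hi.+1 - lo.
  elim: m => [|m IH]; first by rewrite big_ord0; lia.
  by rewrite big_ord_recr /= IH; case: (boolP (_ <= m <= _)); lia.
have := ltn_ord x.1; have := ltn_ord y.1; rewrite /line_dist /layer_between.
case: (leqP x.1 y.1) => xy lt_y lt_x.
  rewrite (eq_bigr (fun i : 'I_r => (x.1 <= i <= y.1) : nat)) ?sumE => [|i _].
    by lia.
  by congr nat_of_bool; lia.
rewrite (eq_bigr (fun i : 'I_r => (y.1 <= i <= x.1) : nat)) ?sumE => [|i _].
    by lia.
  by congr nat_of_bool; lia.
Qed.

(* Outside its wasteful layers a geodesic has no cycle edge. *)
Definition wasteful_layer x y s i : bool := layer_between x y i < layer_count s i.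

(** Of the [line_dist + cycle_dist + 1] vertices, each of the [line_dist + 1] layers between the
    endpoints takes at least one. Each wasteful layer uses one of the remaining [cycle_dist], which
    is at most n/2. *)
Lemma card_wasteful_layers x y s : geodesic E x y s ->
  #|[set i | wasteful_layer x y s i]| <= n %/ 2.
Proof.
move=> geo; have sz := size_geodesic geo.
have : \sum_i (layer_between x y i + wasteful_layer x y s i) <= \sum_i layer_count s i.
  apply: leq_sum => i _; rewrite /wasteful_layer.
  case: geo => /is_pathP[p [-> pp _ lp]] _.
  have := @walk_meets_layer x p i pp; rewrite lp.
  by case: layer_between => [/(_ isT) gt0|_]; case: ltnP => //=; lia.
have card_sum : \sum_i (wasteful_layer x y s i : nat) =
    #|[set i | wasteful_layer x y s i]|.
  by rewrite -sum1dep_card [RHS]big_mkcond; apply: eq_bigr => i _; case: ifP.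
rewrite big_split sum_layer_between card_sum sum_layer_count sz /=.
rewrite /cylinder_dist /cycle_dist.
have := ltn_ord x.2; have := ltn_ord y.2.
rewrite addSn ltnS leq_add2l /line_dist; lia.
Qed.

Lemma wasteful_layer_rev x y s i :
  wasteful_layer y x (rev s) i = wasteful_layer x y s i.
Proof. by rewrite /wasteful_layer /layer_between /layer_count count_rev orbC. Qed.

Lemma strong_geodetic_lower_bound (S : {set 'I_r * 'I_n}) :
  strong_geodetic E S -> 'C(#|S|, 2) * (n %/ 2) + #|S| < r -> 4 * n <= #|S| ^ 2.
Proof.
case=> P [geoP cov] lt_r.
pose W x y := [set i | wasteful_layer x y (P x y) i].
(* Both orientations of a pair waste the same layers, since their paths are reversals of each other;
   indexing by two-element sets yields the binomial coefficient. *)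
pose WA (A : {set 'I_r * 'I_n}) :=
  [set i | [exists x in A, exists y in A, (x != y) && (i \in W x y)]].
pose draws := [set A : {set 'I_r * 'I_n} | A \subset S & #|A| == 2].
have card_WA A : A \in draws -> #|WA A| <= n %/ 2.
  rewrite inE => /andP[/subsetP sAS /cards2P[x [y [neq_xy eqA]]]].
  have [xS yS] : x \in S /\ y \in S.
    by split; apply: sAS; rewrite eqA !inE eqxx ?orbT.
  have [geo_xy Pyx] := geoP x y xS yS neq_xy.
  apply: leq_trans (card_wasteful_layers geo_xy); apply/subset_leq_card/subsetP.
  move=> i; rewrite eqA /WA /W !inE => /exists_inP[u uA /exists_inP[v vA /andP[neq_uv]]].
  move: uA vA neq_uv; rewrite !inE => /orP[]/eqP-> /orP[]/eqP->; rewrite ?eqxx // => _.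
  by rewrite Pyx wasteful_layer_rev.
have card_bad : #|\bigcup_(A in draws) WA A| <= 'C(#|S|, 2) * (n %/ 2).
  rewrite -cards_draws -sum_nat_const.
  apply: (@leq_trans (\sum_(A in draws) #|WA A|)); last by apply: leq_sum.
  elim/big_ind2: _ => [|B1 m1 B2 m2 le1 le2|//]; first by rewrite cards0.
  by apply: leq_trans (leq_add le1 le2); rewrite cardsU leq_subr.
(* Counting: the wasteful layers and the layers meeting S are fewer than r in all. *)
have [i] : exists i, i \notin (\bigcup_(A in draws) WA A) :|: [set x.1 | x in S].
  apply/existsP; apply: contraTT lt_r; rewrite negb_exists -leqNgt => /forallP all_in.
  rewrite -[X in X <= _]card_ord -cardsT.
  apply: leq_trans (leq_add card_bad (leq_imset_card fst S)).
  apply: leq_trans (_ : #|(\bigcup_(A in draws) WA A) :|: [set x.1 | x in S]| <= _); last first.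
    by rewrite cardsU leq_subr.
  by apply/subset_leq_card/subsetP => i _; have := all_in i; rewrite negbK.
rewrite inE negb_or => /andP[good offS].
have thrifty x y : x \in S -> y \in S -> x != y -> ~~ wasteful_layer x y (P x y) i.
  move=> xS yS neq_xy; apply: contra good => bad; apply/bigcupP; exists [set x; y].
    by rewrite inE cards2 neq_xy eqxx andbT subUset !sub1set xS.
  rewrite inE; apply/exists_inP; exists x; first by rewrite !inE eqxx.
  by apply/exists_inP; exists y; rewrite !inE ?eqxx ?orbT // neq_xy.
have off x : x \in S -> x.1 != i.
  by move=> xS; apply: contra offS => /eqP <-; apply: imset_f.
pose lo := [set x in S | x.1 < i]; pose hi := [set x in S | i < x.1].
have /fin_all_exists[f fP] : forall c : 'I_n, exists xy,
    [/\ xy.1 \in lo, xy.2 \in hi & (i, c) \in P xy.1 xy.2].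
  move=> c; have [x [y [xS yS neq_xy inP]]] := cov (i, c).
  have := thrifty _ _ xS yS neq_xy; rewrite /wasteful_layer -leqNgt.
  have : 0 < layer_count (P x y) i.
    by rewrite /layer_count -has_count; apply/hasP; exists (i, c) => /=.
  have := off _ xS; have := off _ yS; rewrite -!val_eqE /= => ny nx gt0 le.
  have : layer_between x y i by case: layer_between le gt0 => //=; case: layer_count.
  have [_ Pyx] := geoP _ _ xS yS neq_xy.
  case/orP=> btw; [exists (x, y)|exists (y, x)]; rewrite !inE xS yS /= ?Pyx ?mem_rev;
    split=> //; clear -nx ny btw; lia.
(* Two columns served by one pair would put two vertices of its geodesic in layer [i], making that
   layer wasteful. *)
have f_inj : injective f.
  move=> c c' eq_f; have [lo1 hi1 in1] := fP c; have [_ _ in2] := fP c'.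
  rewrite -eq_f in in2; move: lo1 hi1; rewrite !inE => /andP[xS lt1] /andP[yS lt2].
  have neq_xy : (f c).1 != (f c).2 by apply: contraTneq lt1 => ->; rewrite -leqNgt ltnW.
  have := thrifty _ _ xS yS neq_xy; rewrite /wasteful_layer -leqNgt.
  have [geo _] := geoP _ _ xS yS neq_xy.
  move=> le; apply/eqP; apply: contraTT le => neq; rewrite -ltnNge.
  apply: leq_ltn_trans (leq_b1 _) _.
  rewrite /layer_count -size_filter.
  apply: (@uniq_leq_size _ [:: (i, c); (i, c')]).
    by rewrite /= inE xpair_eqE eqxx neq.
  by move=> v; rewrite !inE mem_filter => /orP[]/eqP->; rewrite eqxx.
have : n <= #|lo| * #|hi|.
  rewrite -cardsX -[X in X <= _]card_ord -(card_codom f_inj).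
  apply/subset_leq_card/subsetP => _ /codomP[c ->].
  by have [lo1 hi1 _] := fP c; rewrite inE lo1.
have : #|lo| + #|hi| <= #|S|.
  rewrite -cardsUI (_ : lo :&: hi = set0) ?cards0 ?addn0.
    by apply/subset_leq_card/subsetP => x; rewrite !inE -andb_orr => /andP[].
  by apply/setP => x; rewrite !inE; lia.
move=> le_S le_n; apply: leq_trans (_ : (#|lo| + #|hi|) ^ 2 <= _).
  by apply: leq_trans (nat_AGM2 _ _); rewrite leq_mul2l.
by rewrite leq_exp2r.
Qed.

End Cylinder.

(** * Matching columns with top and bottom columns *)

(* In the block [s, s + w) with s = i * b > 0, column s + x is matched with the
   bottom column w - 1 - x, and e is the top column.  The columns left of e are
   reached from the bottom without wrapping around, those right of e by wrapping
   around; both arcs are shortest as soon as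
   n + 2(s + w) - 4 <= 4e <= n + 2(s + w), and clamping e to the block keeps the
   conditions that remain.  In block 0 each column is its own bottom column. *)
Definition top_column (n b i : nat) : nat :=
  let w := minn b (n - i * b) in
  if i == 0 then 0 else maxn (i * b) (minn (i * b + w).-1 ((n + 2 * (i * b + w)) %/ 4)).

Definition bottom_column (n b c : nat) : nat :=
  if c < b then c else (minn b (n - c %/ b * b)).-1 - c %% b.

Section Columns.
Variables n b : nat.
Hypothesis b_gt0 : 0 < b.

Lemma top_column_block c : c < n ->
  top_column n b (c %/ b) < n /\ top_column n b (c %/ b) %/ b = c %/ b.
Proof.
move=> lt_cn; have lt_x := ltn_pmod c b_gt0; have eq_c := divn_eq c b.
set e := top_column _ _ _.
suff [lt_en le_e lt_e] : [/\ e < n, c %/ b * b <= e & e < c %/ b * b + b].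
  split=> //; rewrite -[e](subnKC le_e) divnMDl // [X in _ + X]divn_small ?addn0 //; lia.
rewrite /e /top_column; case: eqP => [->|_]; first by rewrite mul0n; split=> //; lia.
by split; lia.
Qed.

Lemma bottom_column_lt c : c < n -> bottom_column n b c < b /\ bottom_column n b c < n.
Proof. by rewrite /bottom_column; case: ifP => c_b c_n; split=> //; lia. Qed.

(** A top column lies in its own block, so division by b recovers the block; within it the bottom
    column determines the offset [c %% b]. *)
Lemma top_bottom_column_inj c c' : c < n -> c' < n ->
  top_column n b (c %/ b) = top_column n b (c' %/ b) ->
  bottom_column n b c = bottom_column n b c' -> c = c'.
Proof.
move=> lt_c lt_c' eq_top; have := (top_column_block lt_c).2.
rewrite eq_top (top_column_block lt_c').2 => eq_div.
have := ltn_pmod c b_gt0; have := divn_eq c b.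
have := ltn_pmod c' b_gt0; have := divn_eq c' b.
rewrite /bottom_column eq_div; move: (c' %/ b * b) => s.
by case: ifP; case: ifP; lia.
Qed.

Lemma top_bottom_column_dist c : c < n ->
  let e := top_column n b (c %/ b) in let j := bottom_column n b c in
  cycle_dist n e c + cycle_dist n c j = cycle_dist n e j.
Proof.
move=> lt_cn e j; rewrite /e /j /top_column /bottom_column.
case: ltnP => [lt_cb|le_bc].
  by rewrite divn_small //= /cycle_dist /line_dist; lia.
have lt_x := ltn_pmod c b_gt0; have eq_c := divn_eq c b.
have i_gt0 : 0 < c %/ b by rewrite divn_gt0.
have le_bs : b <= c %/ b * b by rewrite leq_pmull.
rewrite gtn_eqF //; move: (c %/ b * b) (c %% b) eq_c lt_x le_bs => s x eq_c lt_xb le_bs.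
subst c; set w := minn b _; set q := _ %/ 4.
have [lt_xw le_wb le_swn] : [/\ x < w, w <= b & s + w <= n] by rewrite /w; split; lia.
have le_q : 4 * q <= n + 2 * (s + w) by rewrite /q; lia.
have ge_q : n + 2 * (s + w) <= 4 * q + 3 by rewrite /q; lia.
move: w q lt_xw le_wb le_swn le_q ge_q => w q lt_xw le_wb le_swn le_q ge_q {e j}.
set e := maxn _ _.
have [le_se le_ew eq_e] :
    [/\ s <= e, e < s + w & [\/ e = q, e = s /\ q <= s | e = (s + w).-1 /\ e <= q]].
  have [lt_qs|le_sq] := ltnP q s.
    have -> : e = s by rewrite /e; lia.
    by split; [lia|lia|apply: Or32; lia].
  have [le_q1|lt_q1] := leqP q (s + w).-1.
    have -> : e = q by rewrite /e; lia.
    by split; [lia|lia|apply: Or31].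
  have -> : e = (s + w).-1 by rewrite /e; lia.
  by split; [lia|lia|apply: Or33; lia].
move: e le_se le_ew eq_e => e le_se le_ew eq_e.
have [j [eq_j eq_w]] : exists j, w.-1 - x = j /\ j + x + 1 = w by exists (w.-1 - x); lia.
rewrite eq_j /cycle_dist /line_dist.
have [lt_js lt_en] : j < s /\ e < n by lia.
(* As j = w - 1 - x, the bounds on 4e give 2(e - j) >= n when column s + x is right of e, and <= n
   when it is left of e. If e is clamped to an end of the block, the side whose bound may fail
   contains no column. *)
have [lt_ec|lt_ce|->] := ltngtP e (s + x).
- have le_n : n <= 2 * (e - j) by case: eq_e; lia.
  clear -lt_cn lt_js lt_en lt_ec le_n.
  by have [-> -> ->] : [/\ e - (s + x) + (s + x - e) = s + x - e,
    s + x - j + (j - (s + x)) = s + x - j & e - j + (j - e) = e - j]; [split|]; lia.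
- have le_n : 2 * (e - j) <= n by case: eq_e; lia.
  clear -lt_cn lt_js lt_en lt_ce le_n.
  by have [-> -> ->] : [/\ e - (s + x) + (s + x - e) = e - (s + x),
    s + x - j + (j - (s + x)) = s + x - j & e - j + (j - e) = e - j]; [split|]; lia.
- by rewrite !subnn min0n.
Qed.

End Columns.

(** * Construction of a strong geodetic set *)

Lemma vertical_walk m n (c : 'I_n) (k : 'I_m.+1) : exists p,
  [/\ path (@cylinder m.+1 n) (ord0, c) p, last (ord0, c) p = (k, c), size p = k &
      forall i : 'I_m.+1, i <= k -> (i, c) \in (ord0, c) :: p].
Proof.
case: k => k; elim: k => [|k IH] lt_k.
  exists [::]; split=> //=; first by congr pair; apply: val_inj.
  by move=> i; rewrite leqn0 inE => /eqP i0; apply/eqP; congr pair; apply: val_inj.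
have [p [pp lp sp inp]] := IH (ltnW lt_k).
exists (rcons p (Ordinal lt_k, c)); split.
- rewrite rcons_path pp lp /cylinder /cartesian_product /path_graph /=.
  by rewrite !eqxx orbT.
- by rewrite last_rcons.
- by rewrite size_rcons sp.
- move=> i; rewrite /= leq_eqVlt -rcons_cons mem_rcons inE => /orP[/eqP eq_i|lt_i].
    by apply/orP; left; apply/eqP; congr pair; apply: val_inj.
  by rewrite inp ?orbT.
Qed.

(** Go from [p] to [c] in the first layer, along the whole column [c], then to [q] in the last
    layer; by hypothesis the total length is the distance. *)
Lemma geodesic_through_column m n (p c q : 'I_n) :
  cycle_dist n p c + cycle_dist n c q = cycle_dist n p q ->
  exists s, geodesic (@cylinder m.+1 n) (ord0, p) (ord_max, q) s /\
            forall i, (i, c) \in s.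
Proof.
move=> dist_c.
have [s1 [p1 l1 sz1]] := exists_shortest_walk (ord0 : 'I_m.+1, p) (ord0, c).
have [s2 [p2 l2 sz2 in2]] := vertical_walk c (ord_max : 'I_m.+1).
have [s3 [p3 l3 sz3]] := exists_shortest_walk (ord_max : 'I_m.+1, c) (ord_max, q).
have lastE : last (ord0, p) (s1 ++ s2 ++ s3) = (ord_max, q).
  by rewrite !last_cat l1 l2 l3.
exists ((ord0, p) :: s1 ++ s2 ++ s3); split.
  rewrite -{1}lastE; apply: shortest_walk_geodesic; first by rewrite !cat_path p1 l1 p2 l2.
  rewrite lastE !size_cat sz1 sz2 sz3 /cylinder_dist /= -dist_c /line_dist /=; lia.
move=> i; have := in2 i (leq_ord i); rewrite inE -cat_cons catA !mem_cat => /predU1P[->|->].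
  by rewrite -{1}l1 mem_last.
by rewrite orbT.
Qed.

Lemma strong_geodetic_upper_bound m n a b : 0 < n -> n <= a * b ->
  exists S : {set 'I_m.+2 * 'I_n},
    strong_geodetic (@cylinder m.+2 n) S /\ #|S| <= a + b.
Proof.
case: n => // n _ le_n; have b_gt0 : 0 < b by case: b le_n; rewrite ?muln0.
(* [inord] sends out-of-range values to column 0. This happens only at indices assigned to no
   column, and collisions can only shrink the set. *)
pose top i : 'I_m.+2 * 'I_n.+1 := (ord0, inord (top_column n.+1 b i)).
pose bottom j : 'I_m.+2 * 'I_n.+1 := (ord_max, inord j).
exists ([set top i | i : 'I_a] :|: [set bottom j | j : 'I_b]); split; last first.
  apply: (@leq_trans (#|[set top i | i : 'I_a]| + #|[set bottom j | j : 'I_b]|)).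
    by rewrite cardsU leq_subr.
  by rewrite leq_add // -[X in _ <= X]card_ord leq_imset_card.
pose w (v : 'I_m.+2 * 'I_n.+1) := (top (v.2 %/ b), bottom (bottom_column n.+1 b v.2)).
have topE (c : 'I_n.+1) : (inord (top_column n.+1 b (c %/ b)) : 'I_n.+1) =
    top_column n.+1 b (c %/ b) :> nat.
  by rewrite inordK //; case: (top_column_block b_gt0 (ltn_ord c)).
have bottomE (c : 'I_n.+1) : (inord (bottom_column n.+1 b c) : 'I_n.+1) =
    bottom_column n.+1 b c :> nat.
  by rewrite inordK //; case: (bottom_column_lt b_gt0 (ltn_ord c)).
(* Each pair serves at most one column, so one geodesic through that column suffices. *)
have w_inj u v : w u = w v -> u.2 = v.2.
  case=> /(congr1 val) + /(congr1 val); rewrite /= !topE !bottomE => eq_top eq_bottom.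
  exact/val_inj/(top_bottom_column_inj b_gt0 _ _ eq_top eq_bottom).
(* Row-major numbering: with at least two layers, the first layer precedes the last. *)
apply: (@strong_geodetic_of_cover _ _ _ (fun v : 'I_m.+2 * 'I_n.+1 => v.1 * n.+1 + v.2) w).
- exact: cylinder_sym.
- move=> [i c] [j d] /= eq_ij.
  have eq_i : i = j :> nat.
    by have := congr1 (divn^~ n.+1) eq_ij; rewrite !divnMDl // !divn_small // !addn0.
  by congr pair; apply: val_inj => //=; move: eq_ij; rewrite eq_i => /addnI.
- move=> v; split=> /=; last by have := ltn_ord (top (v.2 %/ b)).2; rewrite /=; lia.
    have lt_a : v.2 %/ b < a.
      by rewrite ltn_divLR // (leq_trans (ltn_ord _)).
    by rewrite inE; apply/orP; left; apply/imsetP; exists (Ordinal lt_a).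
  have [lt_b _] := bottom_column_lt b_gt0 (ltn_ord v.2).
  by rewrite inE; apply/orP; right; apply/imsetP; exists (Ordinal lt_b).
- move=> x y; case: (pickP (fun v => w v == (x, y))) => [v /eqP wv|no_v].
    have [|s [geo_s col_s]] := @geodesic_through_column m.+1 n.+1 (w v).1.2 v.2 (w v).2.2.
      by rewrite /= topE bottomE; apply: top_bottom_column_dist.
    exists s; split; first by case: wv => <- <-.
    by move=> u; rewrite -wv => /w_inj eq_c; rewrite (surjective_pairing u) eq_c.
  (* A pair serving no column takes an arbitrary geodesic. *)
  have [p [pp lp sp]] := exists_shortest_walk x y.
  exists (x :: p); split; last by move=> v /eqP; rewrite no_v.
  by rewrite -lp; apply: shortest_walk_geodesic; rewrite // lp.
Qed.

(** Squaring 2 sqrt n <= k, with both sides nonnegative, removes the reals: the ceiling is the least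
    k with 4n <= k^2. *)
Lemma ceil_2sqrt_le (R : realType) n k : (ceil_2sqrt R n <= k) = (4 * n <= k ^ 2).
Proof.
rewrite /ceil_2sqrt; set x : R := (2%:R * Num.sqrt n%:R)%R.
have x_ge0 : (0 <= x)%R by rewrite mulr_ge0 ?sqrtr_ge0.
rewrite -lez_nat gez0_abs ?ceil_ge0 //; last by rewrite (lt_le_trans _ x_ge0) ?ltrN10.
rewrite ceil_le_int -[(k%:~R)%R]/(k%:R : R)%R -ler_sqr ?nnegrE //.
by rewrite exprMn sqr_sqrtr // -!natrX -natrM ler_nat.
Qed.

Theorem theorem3p4 (R : realType) (n r : nat) :
  3 <= n ->
  'C(ceil_2sqrt R n, 2) * (n %/ 2) + ceil_2sqrt R n < r ->
  has_sg (cartesian_product (@path_graph r) (@cycle_graph n)) (ceil_2sqrt R n).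
Proof.
move=> n3; move: (ceil_2sqrt_le R n); move: (ceil_2sqrt R n) => k kP lt_r.
have lower (S : {set 'I_r * 'I_n}) : strong_geodetic (@cylinder r n) S -> k <= #|S|.
  (* Assuming |S| < k transfers the hypothesis on r from k to |S| by monotonicity. *)
  move=> geoS; apply: contraT; rewrite -ltnNge => lt_S.
  suff : k <= #|S| by rewrite leqNgt lt_S.
  rewrite kP; apply: strong_geodetic_lower_bound geoS _.
  apply: leq_ltn_trans lt_r; rewrite leq_add ?leq_mul2r ?leq_bin2l ?orbT //; exact: ltnW.
split=> //.
(* For k = 2h + 1, 4n <= k^2 = 4h(h + 1) + 1 forces n <= h(h + 1) by integrality; even k is
   immediate. *)
have le_n : n <= k./2 * uphalf k.
  have := leqnn k; rewrite kP -{1 2}(odd_double_half k) uphalf_half.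
  by case: odd; nia.
have k_gt0 : 0 < k by rewrite lt0n; apply: contraTneq le_n => ->; rewrite -ltnNge; lia.
case: r lt_r lower => [|[|m]] // lt_r lower; first by exfalso; lia.
have [S [geoS le_S]] := strong_geodetic_upper_bound m (ltnW (ltnW n3)) le_n.
exists S; split=> //; apply/eqP; rewrite eqn_leq lower // andbT.
by rewrite (leq_trans le_S) // uphalf_half addnCA addnn odd_double_half.
Qed.
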